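(* Let $A$ be a finitely generated associative $\mathbb{C}$-algebra such that $M_N(A)=0$ for some $N$. Let $\pi:A\to A/M_2(A)$ be the quotient map, fix a multiplicative subset $\bar S\subset A/M_2(A)$ without zero divisors, and let $S:=\pi^{-1}(\bar S)\subset A$. Then the map $$m: A_\star[S^{-1}]\otimes_{A_\star} N_k(A)\longrightarrow N_k(A[S^{-1}]),\qquad a\otimes n\mapsto an,$$ is an isomorphism (for every $k\ge 1$).
   Context: For an associative algebra $A$: $L_1=A$, $L_k=[A,L_{k-1}]$ (spanned by iterated commutators $[a_1,[a_2,[\cdots[a_{k-1},a_k]\cdots]$), $M_k=AL_kA=AL_k$ (the two-sided ideal generated by $L_k$), and $N_k=M_k/M_{k+1}$. $A_\star$ denotes the commutative associative algebra $(A/M_3(A),\star)$ with $a\star b=\tfrac12(ab+ba)$; each $N_k(A)$ is an $A_\star$-module via $a\star n=\tfrac12(an+na)$. The set $S$ satisfies the Ore condition in $A$, and $A[S^{-1}]$ denotes the Ore localization. $A_\star[S^{-1}]$ is the localization of the commutative algebra $A_\star$ at the image of $S$; in the map $m$, $a$ is regarded as an element of $A[S^{-1}]/M_3(A[S^{-1}])$ and $n$ via its image in $N_k(A[S^{-1}])$. *)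

(* Defs.v *)
(* The complex numbers are modelled as  R[i]  (complex numbers
   over a real closed field, mathcomp-real-closed) for an arbitrary
   R : realType (mathcomp-analysis); every realType is isomorphic to the reals,
   so R[i] is (isomorphic to) C. *)
From HB Require Import structures.
From mathcomp Require Import all_boot all_order all_algebra.
From mathcomp Require Import complex.
From mathcomp Require Export reals.
Set Implicit Arguments.
Unset Strict Implicit.
Unset Printing Implicit Defensive.
Import GRing.Theory.
Local Open Scope ring_scope.

Section RingDefs.
Variable T : pzRingType.

Definition commr (x y : T) : T := x * y - y * x.

Inductive zspan (P : T -> Prop) : T -> Prop :=
  | zspan0 : zspan P 0
  | zspan_gen x : P x -> zspan P x
  | zspan_sub x y : zspan P x -> zspan P y -> zspan P (x - y).

(* generators of L_k : iterated commutators [a_1,[a_2,[...,[a_{k-1},a_k]...]]]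
   (for k = 1 every element; the index 0 is unused and treated like 1) *)
Fixpoint Lgen (k : nat) (x : T) : Prop :=
  match k with
  | 0 => True
  | k'.+1 => match k' with
             | 0 => True
             | _.+1 => exists a y, Lgen k' y /\ x = commr a y
             end
  end.

Definition Lk (k : nat) (x : T) : Prop := zspan (Lgen k) x.

Definition Mk (k : nat) (x : T) : Prop :=
  zspan (fun y => exists a l b, Lk k l /\ y = a * l * b) x.

(* symmetrized product  a * b = h (ab + ba), with h playing the role of 1/2 *)
Definition starp (h x y : T) : T := h * (x * y + y * x).

End RingDefs.

Section AlgDefs.
Variable F : fieldType.
Variable A : algType F.

Definition halfA : A := (2%:R)^-1 *: 1.

Inductive in_gen_alg (X : seq A) : A -> Prop :=
  | iga_one : in_gen_alg X 1
  | iga_gen x : x \in X -> in_gen_alg X x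
  | iga_add x y : in_gen_alg X x -> in_gen_alg X y -> in_gen_alg X (x + y)
  | iga_scale (c : F) x : in_gen_alg X x -> in_gen_alg X (c *: x)
  | iga_mul x y : in_gen_alg X x -> in_gen_alg X y -> in_gen_alg X (x * y).

Definition fin_gen_alg : Prop := exists X : seq A, forall x, in_gen_alg X x.

(* S = pi^{-1}(Sbar) where Sbar is a multiplicative subset of A/M_2(A)
   without zero divisors; encoded as a subset of A saturated modulo M_2(A). *)
Definition preimage_of_mult_nzd (S : A -> Prop) : Prop :=
  (forall x y, S x -> Mk 2 (x - y) -> S y) /\
  S 1 /\
  (forall x y, S x -> S y -> S (x * y)) /\
  (forall x y, S x -> Mk 2 (x * y) -> Mk 2 y) /\
  (forall x y, S x -> Mk 2 (y * x) -> Mk 2 y).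

(* (R, phi) is the localization A_star[S^{-1}] of the commutative algebra
   A_star = (A/M_3(A), star) at the image of S; phi : A -> R is the composite
   A -> A_star -> A_star[S^{-1}] (characterized by the usual properties). *)
Definition is_star_localization (S : A -> Prop) (R : comPzRingType)
    (phi : A -> R) : Prop :=
  (((forall x y, phi (x - y) = phi x - phi y)) /\
     (phi 1 = 1) /\
     ((forall x y, phi (starp halfA x y) = phi x * phi y)) /\
     ((forall s, S s -> exists u, phi s * u = 1)) /\
     ((forall r, exists a s, S s /\ r * phi s = phi a)) /\
     ((forall a, phi a = 0 <-> exists s, S s /\ Mk 3 (starp halfA a s)))).

Definition is_ore_localization (S : A -> Prop) (B : pzRingType)
    (j : A -> B) : Prop :=
  (((forall x y, j (x - y) = j x - j y)) /\
     ((forall x y, j (x * y) = j x * j y)) /\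
     (j 1 = 1) /\
     ((forall s, S s -> exists u, j s * u = 1 /\ u * j s = 1)) /\
     ((forall b, exists a s, S s /\ b * j s = j a)) /\
     ((forall a, j a = 0 <-> exists s, S s /\ a * s = 0))).

(* f : A_star[S^{-1}] x N_k(A) -> W is biadditive and A_star-balanced
   (elements of N_k(A) are represented by elements of M_k(A)). *)
Definition balanced_map (k : nat) (R : comPzRingType) (phi : A -> R)
    (W : zmodType) (f : R -> A -> W) : Prop :=
  (((forall r1 r2 n, Mk k n -> f (r1 + r2) n = f r1 n + f r2 n)) /\
     ((forall r n1 n2, Mk k n1 -> Mk k n2 -> f r (n1 + n2) = f r n1 + f r n2)) /\
     ((forall r n, Mk k.+1 n -> f r n = 0)) /\
     ((forall r c n, Mk k n -> f (r * phi c) n = f r (starp halfA c n)))).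

(* g : N_k(A[S^{-1}]) -> W additive (represented on M_k(B), vanishing on
   M_{k+1}(B)) with g (m (r (x) n)) = f r n, where
   m (r (x) n) = r * n  with r = phi(a) phi(s)^{-1} regarded in
   A[S^{-1}]/M_3(A[S^{-1}]) as  j(a) * j(s)^{-1}  (star products). *)
Definition factors_through_m (k : nat) (S : A -> Prop) (R : comPzRingType)
    (phi : A -> R) (B : pzRingType) (j : A -> B) (W : zmodType)
    (f : R -> A -> W) (g : B -> W) : Prop :=
  (((forall x y, Mk k x -> Mk k y -> g (x + y) = g x + g y)) /\
     ((forall x, Mk k.+1 x -> g x = 0)) /\
     ((forall r a s u n, S s -> r * phi s = phi a -> j s * u = 1 -> Mk k n ->
         g (starp (j halfA) (starp (j halfA) (j a) u) (j n)) = f r n))).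

(* m : A_star[S^{-1}] (x)_{A_star} N_k(A) -> N_k(A[S^{-1}]) is an isomorphism,
   i.e. (N_k(A[S^{-1}]), (r, n) |-> m (r (x) n)) satisfies the universal
   property of the tensor product. *)
Definition m_is_iso (k : nat) (S : A -> Prop) (R : comPzRingType)
    (phi : A -> R) (B : pzRingType) (j : A -> B) : Prop :=
  forall (W : zmodType) (f : R -> A -> W),
    balanced_map k phi f ->
    (exists g : B -> W, factors_through_m k S phi j f g) /\
    (forall g1 g2 : B -> W, factors_through_m k S phi j f g1 ->
       factors_through_m k S phi j f g2 -> forall x, Mk k x -> g1 x = g2 x).

End AlgDefs.

(* Main.v *)
(* A is Lie nilpotent, so every ad s is nilpotent on A and elements of A can be
   moved past powers of s; hence the fractions n s^-1 with n in M_k(A) form an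
   ideal of B = A[S^{-1}].  This ideal is M_k(B): for entries x_i with common
   denominator s, [x_1 s^m,[x_2 s^m,...]] is a polynomial in m times a power of s
   and lies in the image of L_k(A) for all m > 0, so its value at m = 0 is a
   fraction as well.

   On the other hand M_3 M_k is contained in M_{k+1}, so that [b,[a,n]] = 0 in N_k;
   therefore N_k is a module for the star product and (s s) * n = s n s in N_k.
   This turns right fractions x s = n into star fractions (s s) * x = s n, and
   shows that N_k(B) is the localization of the A_star-module N_k(A) at S. *)
From Stdlib Require Import Ncring Ncring_tac.
Require Import Defs.
From mathcomp Require Import all_boot all_order all_algebra.
From mathcomp Require Import complex.
From mathcomp Require Import reals.
From mathcomp Require Import classical_sets.
Import GRing.Theory.
Local Open Scope ring_scope.
Set Implicit Arguments.
Unset Strict Implicit.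

(** * Instances behind the noncommutative ring tactic *)

#[local] Instance pzRing_ops (T : pzRingType) :
  @Ring_ops T 0 1 +%R *%R (fun x y => x - y) (@GRing.opp T) (@eq T).
Proof. Defined.

#[local] Instance pzRing_ring (T : pzRingType) :
  Ring (T := T) (Ro := pzRing_ops T).
Proof.
constructor; try exact _.
- by move=> x; exact: (add0r x).
- by move=> x y; exact: (addrC x y).
- by move=> x y z; exact: (addrA x y z).
- by move=> x; exact: (mul1r x).
- by move=> x; exact: (mulr1 x).
- by move=> x y z; exact: (mulrA x y z).
- by move=> x y z; exact: (mulrDl x y z).
- by move=> x y z; exact: (mulrDr z x y).
- by [].
- by move=> x; exact: (subrr x).
Qed.

(** * The ideals M_k of an arbitrary ring *)

Section NoncommutativeRing.
Variable T : pzRingType.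

Section Span.
Variable P : T -> Prop.

Lemma zspan_opp x : zspan P x -> zspan P (- x).
Proof. by move=> Px; rewrite -sub0r; apply: zspan_sub => //; apply: zspan0. Qed.

Lemma zspan_add x y : zspan P x -> zspan P y -> zspan P (x + y).
Proof. by move=> Px Py; rewrite -[y]opprK; apply/zspan_sub/zspan_opp. Qed.

End Span.

Lemma Lgen_comm k (a y : T) : (0 < k)%N -> Lgen k y -> Lgen k.+1 (commr a y).
Proof. by case: k => // k _ Ly; exists a, y. Qed.

Lemma LgenW k (x : T) : Lgen k.+1 x -> Lgen k x.
Proof.
elim: k x => // -[//|k] IH x [a [y [Ly ->]]].
by apply: Lgen_comm => //; apply: IH.
Qed.

Lemma Lgen_iter_comm k (s a : T) : Lgen k.+1 (iter k (commr s) a).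
Proof. by elim: k => // k IH; apply: Lgen_comm. Qed.

Lemma Mk0 k : Mk k (0 : T). Proof. exact: zspan0. Qed.

Lemma Mk_sub k (x y : T) : Mk k x -> Mk k y -> Mk k (x - y).
Proof. exact: zspan_sub. Qed.

Lemma Mk_opp k (x : T) : Mk k x -> Mk k (- x).
Proof. exact: zspan_opp. Qed.

Lemma Mk_add k (x y : T) : Mk k x -> Mk k y -> Mk k (x + y).
Proof. exact: zspan_add. Qed.

Lemma Mk_mull k (c x : T) : Mk k x -> Mk k (c * x).
Proof.
elim=> [|_ [a [l [b [Ll ->]]]]|y z _ IHy _ IHz].
- by rewrite mulr0; apply: Mk0.
- by apply: zspan_gen; exists (c * a), l, b; rewrite !mulrA.
- by rewrite mulrBr; apply: Mk_sub.
Qed.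

Lemma Mk_mulr k (c x : T) : Mk k x -> Mk k (x * c).
Proof.
elim=> [|_ [a [l [b [Ll ->]]]]|y z _ IHy _ IHz].
- by rewrite mul0r; apply: Mk0.
- by apply: zspan_gen; exists a, l, (b * c); rewrite !mulrA.
- by rewrite mulrBl; apply: Mk_sub.
Qed.

Lemma Mk_comm k (c x : T) : Mk k x -> Mk k (commr c x).
Proof. by move=> Mx; apply: Mk_sub; [apply: Mk_mull | apply: Mk_mulr]. Qed.

Lemma Mk_Lgen k (x : T) : Lgen k x -> Mk k x.
Proof.
move=> Lx; apply: zspan_gen; exists 1, x, 1; rewrite mul1r mulr1.
by split=> //; apply: zspan_gen.
Qed.

(** This is A L_k A = A L_k: moving a right factor b across a generator g costs [b,g], which is
    again a generator of L_k because L_{k+1} lies in L_k. *)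
Lemma Mk_left_span k (x : T) : (0 < k)%N -> Mk k x ->
  zspan (fun y => exists a g, Lgen k g /\ y = a * g) x.
Proof.
move=> k_gt0; elim=> [|_ [a [l [b [Ll ->]]]]|y z _ IHy _ IHz].
- exact: zspan0.
- elim: Ll => [|g Lg|y z _ IHy _ IHz].
  + by rewrite mulr0 mul0r; apply: zspan0.
  + have -> : a * g * b = (a * b) * g - a * commr b g
      by rewrite /commr; non_commutative_ring.
    apply: zspan_sub; apply: zspan_gen; first by exists (a * b), g.
    by exists a, (commr b g); split=> //; apply/LgenW/Lgen_comm.
  + by rewrite mulrBr mulrBl; apply: zspan_sub.
- exact: zspan_sub.
Qed.

Lemma Mk_ind_left k (P : T -> Prop) : (0 < k)%N -> P 0 ->
  (forall x y, P x -> P y -> P (x - y)) ->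
  (forall a g, Lgen k g -> P (a * g)) -> forall x, Mk k x -> P x.
Proof.
move=> k_gt0 P0 PB Pg x /(Mk_left_span k_gt0).
by elim=> [//|_ [a [g [Lg ->]]]|y z _ Py _ Pz]; [apply: Pg | apply: PB].
Qed.

Lemma MkW k (x : T) : (0 < k)%N -> Mk k.+1 x -> Mk k x.
Proof.
move=> k_gt0; move: x; apply: Mk_ind_left => // [|x y|a g Lg].
- exact: Mk0.
- exact: Mk_sub.
- by apply/Mk_mull/Mk_Lgen/LgenW.
Qed.

(** Expand [a,[b,[cd,m]]] by the Leibniz rule. Apart from the two products in the statement, every
    term contains at least two nested commutators applied to m, hence lies in M_{k+2}. *)
Lemma L3_mul_antisym k (a b c d m : T) : (0 < k)%N -> Lgen k m ->
  Mk k.+2 (commr a (commr b c) * commr d m + commr a (commr b d) * commr c m).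
Proof.
move=> k_gt0 Lm.
have L1 x : Lgen k.+1 (commr x m) by apply: Lgen_comm.
have L2 x y : Lgen k.+2 (commr x (commr y m)) by apply: Lgen_comm.
have -> : commr a (commr b c) * commr d m + commr a (commr b d) * commr c m
  = commr a (commr b (commr (c * d) m)) + commr a (commr b (commr d (commr c m)))
    - (commr a c * commr b (commr d m) + c * commr a (commr b (commr d m))
       + commr b c * commr a (commr d m))
    - (commr a d * commr b (commr c m) + d * commr a (commr b (commr c m))
       + commr b d * commr a (commr c m)).
  by rewrite /commr; non_commutative_ring.
have M2 x y z : Mk k.+2 (z * commr x (commr y m)) by apply/Mk_mull/Mk_Lgen.
have M3 x y z w : Mk k.+2 (w * commr x (commr y (commr z m))) by
  apply/Mk_mull/Mk_comm/Mk_Lgen.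
have M4 x y z w : Mk k.+2 (commr x (commr y (commr z (commr w m)))) by
  do 2!apply: Mk_comm; apply: Mk_Lgen.
have M1 x y z : Mk k.+2 (commr x (commr y (commr z m))) by
  apply/Mk_comm/Mk_Lgen.
by do ![first [exact: M1 | exact: M2 | exact: M3 | exact: M4
  | apply: Mk_sub | apply: Mk_add]].
Qed.

(* L3_mul_antisym makes the product [a,[b,c]] [d,m] alternating in b, c, d
   modulo M_{k+2}; the Jacobi identities in the triples of {a,b,c,d} then leave
   a linear system whose only solution is 3-torsion. *)
Lemma L3_mul_triple k (a b c d m : T) : (0 < k)%N -> Lgen k m ->
  Mk k.+2 ((commr c (commr a b) * commr d m) *+ 3).
Proof.
move=> k_gt0 Lm.
pose f x y z w := commr x (commr y z) * commr w m.
pose g x y z w := f x y z w + f x y w z.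
have Mg x y z w : Mk k.+2 (g x y z w) by apply: L3_mul_antisym.
have -> : (commr c (commr a b) * commr d m) *+ 3
  = g b a c d - g a b c d + (g b a c d - g a b c d)
    - g a c b d + g c a b d - g d a b c + g b c a d - g c b a d + g d b a c.
  by rewrite /g /f !mulrS mulr0n /commr; non_commutative_ring.
by do ![first [exact: Mg | apply: Mk_sub | apply: Mk_add]].
Qed.

(** * Products with L_3 and double commutators when 3 is invertible *)

Section Thirds.
Variable t : T.
Hypothesis t3 : t *+ 3 = 1.

Lemma L3_mul_Lgen k (p g : T) : (0 < k)%N -> Lgen 3 p -> Lgen k g ->
  Mk k.+1 (p * g).
Proof.
case: k => // k _ [c [_ [[a [b [_ ->]]] ->]]].
case: k => [|k] Lg; last first.
  case: Lg => d [m [Lm ->]].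
  have -> : commr c (commr a b) * commr d m
    = t * ((commr c (commr a b) * commr d m) *+ 3).
    by rewrite mulrnAr -mulrnAl t3 mul1r.
  exact/Mk_mull/L3_mul_triple.
(* For k = 1 the target is M_2, which contains the commutator p itself. *)
apply/Mk_mulr/Mk_Lgen; exact: (Lgen_comm (k := 1)).
Qed.

Lemma L3_mul_Mk k (p n : T) : (0 < k)%N -> Lgen 3 p -> Mk k n ->
  Mk k.+1 (p * n).
Proof.
move=> k_gt0 Lp; move: n; apply: Mk_ind_left => // [|x y Mx My|a g Lg].
- by rewrite mulr0; apply: Mk0.
- by rewrite mulrBr; apply: Mk_sub.
(* The correction [a,p] lies in L_4, hence in L_3, so both terms reduce to the case of
   generators. *)
- have -> : p * (a * g) = a * (p * g) - commr a p * g.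
    by rewrite /commr; non_commutative_ring.
  apply: Mk_sub; first exact/Mk_mull/L3_mul_Lgen.
  by apply: L3_mul_Lgen => //; apply/LgenW/Lgen_comm.
Qed.

Lemma Mk_mul_L3 k (p n : T) : (0 < k)%N -> Lgen 3 p -> Mk k n ->
  Mk k.+1 (n * p).
Proof.
move=> k_gt0 Lp; move: n; apply: Mk_ind_left => // [|x y Mx My|a g Lg].
- by rewrite mul0r; apply: Mk0.
- by rewrite mulrBl; apply: Mk_sub.
- have -> : a * g * p = a * (p * g) - a * commr p g.
    by rewrite /commr; non_commutative_ring.
  apply: Mk_sub; apply: Mk_mull; first exact: L3_mul_Lgen.
  exact/Mk_Lgen/Lgen_comm.
Qed.

(** In the Leibniz expansion on c g, the only term without a commutator of g is [b,[a,c]] g, a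
    product of L_3 with L_k. This lemma is what makes the star action on N_k associative. *)
Lemma Mk_comm_comm k (a b n : T) : (0 < k)%N -> Mk k n ->
  Mk k.+1 (commr b (commr a n)).
Proof.
move=> k_gt0; move: n; apply: Mk_ind_left => // [|x y Mx My|c g Lg].
- by rewrite /commr !(mulr0, mul0r, subrr); apply: Mk0.
- have -> : commr b (commr a (x - y)) = commr b (commr a x) - commr b (commr a y).
    by rewrite /commr; non_commutative_ring.
  exact: Mk_sub.
- have -> : commr b (commr a (c * g)) = commr b (commr a c) * g
    + commr a c * commr b g + commr b c * commr a g + c * commr b (commr a g).
    by rewrite /commr; non_commutative_ring.
  have Lc x : Mk k.+1 (commr x g) by apply/Mk_Lgen/Lgen_comm.
  do ![apply: Mk_add]; try exact: Mk_mull; last exact/Mk_mull/Mk_comm.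
  by apply: L3_mul_Lgen => //; do 2!apply: Lgen_comm => //.
Qed.

(** * The star action on N_k when 2 is invertible *)

Section Halves.
Variable h : T.
Hypothesis h2 : h + h = 1.

(** The commutator c of h and x satisfies 2c = 0, because 2h = 1 is central; hence c = h (2c) =
    0. *)
Lemma half_central x : h * x = x * h.
Proof.
apply/eqP; rewrite -subr_eq0; set c := _ - _; apply/eqP.
have c2 : c + c = 0.
  have -> : c + c = (h + h) * x - x * (h + h) by rewrite /c; non_commutative_ring.
  by rewrite h2 mul1r mulr1 subrr.
have -> : c = h * (c + c) by rewrite mulrDr -mulrDl h2 mul1r.
by rewrite c2 mulr0.
Qed.

Lemma half_mulCA x y : x * (h * y) = h * (x * y).
Proof. by rewrite mulrA -half_central mulrA. Qed.

Lemma mul_half_add x : h * (x + x) = x.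
Proof. by rewrite mulrDr -mulrDl h2 mul1r. Qed.

Lemma starpDr a x y : starp h a (x + y) = starp h a x + starp h a y.
Proof. rewrite /starp; non_commutative_ring. Qed.

Lemma starpBr a x y : starp h a (x - y) = starp h a x - starp h a y.
Proof. rewrite /starp; non_commutative_ring. Qed.

Lemma starpDl a b x : starp h (a + b) x = starp h a x + starp h b x.
Proof. rewrite /starp; non_commutative_ring. Qed.

Lemma starpC a b : starp h a b = starp h b a.
Proof. rewrite /starp; non_commutative_ring. Qed.

Lemma starp1 x : starp h 1 x = x.
Proof. by rewrite /starp mul1r mulr1 mul_half_add. Qed.

Lemma starpA_comm a b x :
  starp h a (starp h b x) = starp h (starp h a b) x - h * (h * commr b (commr a x)).
Proof.
by rewrite /starp !half_mulCA /commr; non_commutative_ring.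
Qed.

Lemma Mk_starp k a x : Mk k x -> Mk k (starp h a x).
Proof.
by move=> Mx; apply/Mk_mull/Mk_add; [apply: Mk_mull | apply: Mk_mulr].
Qed.

Section Module.
Variable k : nat.
Hypothesis k_gt0 : (0 < k)%N.

Lemma starpA_Mk a b x : Mk k x ->
  Mk k.+1 (starp h a (starp h b x) - starp h (starp h a b) x).
Proof.
move=> Mx; rewrite starpA_comm addrC addKr; apply: Mk_opp.
by do 2!apply: Mk_mull; apply: Mk_comm_comm.
Qed.

Lemma starpCA_Mk a b x : Mk k x ->
  Mk k.+1 (starp h a (starp h b x) - starp h b (starp h a x)).
Proof.
move=> Mx; rewrite -(subrKA (starp h (starp h a b) x)) addrC.
rewrite {1}(starpC a b).
by apply: Mk_add; first (rewrite -opprB; apply: Mk_opp); apply: starpA_Mk.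
Qed.

Lemma starp_sqr_Mk s x : Mk k x -> Mk k.+1 (starp h (s * s) x - s * x * s).
Proof.
move=> Mx; rewrite -{1}(mul_half_add (s * x * s)) /starp -mulrBr.
have -> : s * s * x + x * (s * s) - (s * x * s + s * x * s)
  = commr s (commr s x) by rewrite /commr; non_commutative_ring.
exact/Mk_mull/Mk_comm_comm.
Qed.

(** The star product of a with the inverse u of s acts on N_k as the fraction a/s: its star product
    with s is a plus a quarter of [s,[a,u]], and an element of L_3 acts as zero on N_k. *)
Lemma starp_inv_Mk s u a x : s * u = 1 -> u * s = 1 -> Mk k x ->
  Mk k.+1 (starp h s (starp h (starp h a u) x) - starp h a x).
Proof.
move=> su us Mx.
have e : starp h s (starp h a u) = a + h * (h * commr s (commr a u)).
  have -> : starp h s (starp h a u) = h * (h * (commr s (commr a u)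
      + (s * u * a + a * (u * s) + (s * u * a + a * (u * s))))).
    by rewrite /starp half_mulCA /commr; non_commutative_ring.
  by rewrite su us mul1r mulr1 [h * (_ + _)]mulrDr mul_half_add mulrDr mul_half_add addrC.
have := starpA_Mk s (starp h a u) Mx.
rewrite e starpDl opprD addrA => M1.
rewrite -[X in Mk _ X](subrK (starp h (h * (h * commr s (commr a u))) x)).
apply: Mk_add => //; rewrite /starp; apply: Mk_mull.
have Lp : Lgen 3 (commr s (commr a u)) by do 2!apply: Lgen_comm => //.
apply: Mk_add; first by rewrite -!mulrA; do 2!apply: Mk_mull; apply: L3_mul_Mk.
rewrite !half_central -!mulrA !mulrA; do 2!apply: Mk_mulr; exact: Mk_mul_L3.
Qed.

End Module.
End Halves.
End Thirds.
End NoncommutativeRing.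

(** * Twisted finite differences and extrapolation to m = 0 *)

Section FiniteDifferences.
Variables (T : pzRingType) (s : T).

(* F behaves like s^(c m) times a polynomial in m: it is killed by d successive
   operators, each being either E - (s^c * _), with E the shift, or ad s. *)
Fixpoint quasipoly (c d : nat) (F : nat -> T) : Prop :=
  match d with
  | 0 => forall m, F m = 0
  | d'.+1 => quasipoly c d' (fun m => F m.+1 - s ^+ c * F m) /\
             quasipoly c d' (fun m => commr s (F m))
  end.

Lemma quasipoly_ext c d F G : F =1 G -> quasipoly c d F -> quasipoly c d G.
Proof.
elim: d F G => [|d IH] F G FG /=; first by move=> F0 m; rewrite -FG.
by case=> Q1 Q2; split; [apply: IH Q1 | apply: IH Q2] => m /=; rewrite !FG.
Qed.

Lemma quasipoly0 c d : quasipoly c d (fun _ => 0).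
Proof.
elim: d => [|d IH] //=; split; apply: quasipoly_ext IH => m /=.
- by rewrite mulr0 subrr.
- by rewrite /commr mulr0 mul0r subrr.
Qed.

Lemma quasipolyB c d F G : quasipoly c d F -> quasipoly c d G ->
  quasipoly c d (fun m => F m - G m).
Proof.
elim: d F G => [|d IH] F G /=; first by move=> F0 G0 m; rewrite F0 G0 subrr.
move=> [F1 F2] [G1 G2]; split.
- apply: quasipoly_ext (IH _ _ F1 G1) => m /=; non_commutative_ring.
- apply: quasipoly_ext (IH _ _ F2 G2) => m /=; rewrite /commr; non_commutative_ring.
Qed.

Lemma quasipolyN c d F : quasipoly c d F -> quasipoly c d (fun m => - F m).
Proof.
move=> Q; apply: quasipoly_ext (quasipolyB (quasipoly0 c d) Q) => m /=.
exact: sub0r.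
Qed.

Lemma quasipolyD c d F G : quasipoly c d F -> quasipoly c d G ->
  quasipoly c d (fun m => F m + G m).
Proof.
move=> QF /quasipolyN QG; apply: quasipoly_ext (quasipolyB QF QG) => m /=.
by rewrite opprK.
Qed.

Lemma quasipoly_shift c d F : quasipoly c d F -> quasipoly c d (fun m => F m.+1).
Proof. by elim: d F => [|d IH] F //= [Q1 Q2]; split; [apply: IH Q1 | apply: IH Q2]. Qed.

Lemma quasipoly_mull c d F : quasipoly c d F -> quasipoly c d (fun m => s * F m).
Proof.
elim: d F => [|d IH] F /=; first by move=> F0 m; rewrite F0 mulr0.
case=> /IH Q1 /IH Q2; split.
- by apply: quasipoly_ext Q1 => m; rewrite mulrBr !mulrA -exprS -exprSr.
- by apply: quasipoly_ext Q2 => m; rewrite /commr; non_commutative_ring.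
Qed.

Lemma quasipoly_mulr c d F : quasipoly c d F -> quasipoly c d (fun m => F m * s).
Proof.
elim: d F => [|d IH] F /=; first by move=> F0 m; rewrite F0 mul0r.
case=> /IH Q1 /IH Q2; split.
- by apply: quasipoly_ext Q1 => m; rewrite mulrBl mulrA.
- by apply: quasipoly_ext Q2 => m; rewrite /commr; non_commutative_ring.
Qed.

Lemma quasipoly_mulXl c d n F :
  quasipoly c d F -> quasipoly c d (fun m => s ^+ n * F m).
Proof.
move=> Q; elim: n => [|n /quasipoly_mull].
  by apply: quasipoly_ext Q => m; rewrite mul1r.
by apply: quasipoly_ext => m; rewrite exprS mulrA.
Qed.

Lemma quasipoly_mulXr c d n F :
  quasipoly c d F -> quasipoly c d (fun m => F m * s ^+ n).
Proof.
move=> Q; elim: n => [|n /quasipoly_mulr].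
  by apply: quasipoly_ext Q => m; rewrite mulr1.
by apply: quasipoly_ext => m; rewrite exprSr mulrA.
Qed.

Lemma quasipoly_commX c d n F : quasipoly c d.+1 F ->
  quasipoly c d (fun m => commr (s ^+ n) (F m)).
Proof.
case=> _ Q; elim: n => [|n /quasipoly_mull IH].
  apply: quasipoly_ext (quasipoly0 c d) => m.
  by rewrite /commr mul1r mulr1 subrr.
apply: quasipoly_ext (quasipolyD IH (quasipoly_mulXr n Q)) => m.
by rewrite /commr exprS; non_commutative_ring.
Qed.

(** Induction on d + d' with a twisted Leibniz rule. The difference of F G is the difference of F
    times the shift of G, plus s^c F times the difference of G, minus [s^c', s^c F] G. The last term
    has lower order because ad s is one of the two operators in [quasipoly]. *)
Lemma quasipolyM c c' d d' F G : quasipoly c d F -> quasipoly c' d' G ->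
  quasipoly (c + c') (d + d') (fun m => F m * G m).
Proof.
have [n] := ubnP (d + d'); elim: n => // n IH in d d' F G *.
case: d => [|d] lt_n QF QG.
  by apply: quasipoly_ext (quasipoly0 _ _) => m; rewrite QF mul0r.
case: d' => [|d'] in lt_n QG *.
  by apply: quasipoly_ext (quasipoly0 _ _) => m; rewrite QG mulr0.
have lt1 : (d + d'.+1 < n)%N by [].
have lt2 : (d.+1 + d' < n)%N by rewrite addSnnS.
have [QF1 QF2] := QF; have [QG1 QG2] := QG.
rewrite addSn; split.
- have Q1 := IH _ _ _ _ lt1 QF1 (quasipoly_shift QG).
  have Q2 := IH _ _ _ _ lt2 (quasipoly_mulXl c QF) QG1.
  have Q3 := IH _ _ _ _ lt1 (quasipoly_commX c' (quasipoly_mulXl c QF)) QG.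
  rewrite addSnnS in Q2.
  apply: quasipoly_ext (quasipolyB (quasipolyD Q1 Q2) Q3) => m.
  by rewrite /commr addnC exprD; non_commutative_ring.
- have Q1 := IH _ _ _ _ lt1 QF2 QG.
  have Q2 := IH _ _ _ _ lt2 QF QG2.
  rewrite addSnnS in Q2.
  apply: quasipoly_ext (quasipolyD Q1 Q2) => m.
  by rewrite /commr; non_commutative_ring.
Qed.

Lemma quasipoly_comm c c' F G :
  (exists d, quasipoly c d F) -> (exists d, quasipoly c' d G) ->
  exists d, quasipoly (c + c') d (fun m => commr (F m) (G m)).
Proof.
move=> [d QF] [d' QG]; exists (d + d')%N; apply: quasipolyB; first exact: quasipolyM.
by rewrite addnC [(d + d')%N]addnC; apply: quasipolyM.
Qed.

(** On x s^m the twisted difference replaces the coefficient x by -[s,x] and ad s replaces it by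
    [s,x], so the order is bounded by the nilpotency of ad s at x. *)
Lemma quasipoly_monomial d x : iter d (commr s) x = 0 ->
  quasipoly 1 d (fun m => x * s ^+ m).
Proof.
elim: d x => [|d IH] x; first by move=> /= -> m; rewrite mul0r.
rewrite iterSr => /IH Q; split.
- apply: quasipoly_ext (quasipolyN Q) => m.
  by rewrite /commr exprS expr1; non_commutative_ring.
- apply: quasipoly_ext Q => m.
  rewrite /commr -!mulrA -exprSr exprS; non_commutative_ring.
Qed.

(** The twisted difference has smaller order, so by induction its value at 0 lies in the left ideal
    I. Together with F 1 this puts s^c F 0 in I, and u cancels s^c. *)
Lemma quasipoly_extrapolate c d F (I : T -> Prop) (u : T) : u * s = 1 ->
  (forall x y, I x -> I y -> I (x - y)) -> (forall a x, I x -> I (a * x)) ->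
  quasipoly c d F -> (forall m, I (F m.+1)) -> I (F 0%N).
Proof.
move=> us IB IM; elim: d F => [|d IH] F.
  by move=> F0 /(_ 0%N)/(IM 0); rewrite !F0 mul0r.
move=> [/IH Q _] IF.
have /Q I0 : forall m, I (F m.+2 - s ^+ c * F m.+1).
  by move=> m; apply/IB/IM.
have := IB _ _ (IF 0%N) I0; rewrite subKr; elim: c {IH Q I0} => [|c IHc].
  by rewrite mul1r.
by move=> /(IM u); rewrite exprS !mulrA us mul1r.
Qed.

End FiniteDifferences.

(** * Ore localization of a Lie nilpotent algebra *)

Section OreLocalization.
Variables (K : fieldType) (A : algType K) (S : A -> Prop).
Variables (B : pzRingType) (j : A -> B).
Hypothesis S1 : S 1.
Hypothesis SM : forall x y, S x -> S y -> S (x * y).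
Hypothesis A_nil : exists N : nat, forall x : A, Mk N x -> x = 0.
Hypothesis jloc : is_ore_localization S j.

Let jB x y : j (x - y) = j x - j y. Proof. by case: jloc. Qed.
Let jM x y : j (x * y) = j x * j y. Proof. by case: jloc => _ []. Qed.
Let j1 : j 1 = 1. Proof. by case: jloc => _ [_ []]. Qed.
Let jinv s : S s -> exists u, j s * u = 1 /\ u * j s = 1.
Proof. by case: jloc => _ [_ [_ [+ _]]]; apply. Qed.
Let jfrac b : exists a s, S s /\ b * j s = j a.
Proof. by case: jloc => _ [_ [_ [_ []]]]. Qed.
Let jker a : j a = 0 <-> exists s, S s /\ a * s = 0.
Proof. by case: jloc => _ [_ [_ [_ []]]]. Qed.

Let j0 : j 0 = 0. Proof. by rewrite -(subrr 0) jB subrr. Qed.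
Let jN x : j (- x) = - j x. Proof. by rewrite -sub0r jB j0 sub0r. Qed.
Let jD x y : j (x + y) = j x + j y.
Proof. by rewrite -[y in LHS]opprK jB jN opprK. Qed.
Let jX x n : j (x ^+ n) = j x ^+ n.
Proof. by elim: n => // n IH; rewrite !exprS jM IH. Qed.
Let jcomm x y : j (commr x y) = commr (j x) (j y).
Proof. by rewrite /commr jB !jM. Qed.

Let SX s n : S s -> S (s ^+ n).
Proof. by move=> Ss; elim: n => // n IH; rewrite exprS; apply: SM. Qed.

Lemma Lgen_map k n : Lgen k n -> Lgen k (j n).
Proof.
elim: k n => // -[//|k] IH n [a [y [Ly ->]]].
by rewrite jcomm; apply: Lgen_comm => //; apply: IH.
Qed.

Lemma Mk_map k n : Mk k n -> Mk k (j n).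
Proof.
elim=> [|_ [a [l [b [Ll ->]]]]|x y _ IHx _ IHy].
- by rewrite j0; apply: Mk0.
- rewrite !jM; apply/Mk_mulr/Mk_mull.
  elim: Ll => [|x Lx|x y _ IHx _ IHy].
  + by rewrite j0; apply: Mk0.
  + by apply/Mk_Lgen/Lgen_map.
  + by rewrite jB; apply: Mk_sub.
- by rewrite jB; apply: Mk_sub.
Qed.

Lemma comm_nilpotent : exists d, forall t a : A, iter d (commr t) a = 0.
Proof.
have [N AN] := A_nil; exists N => t a.
by apply/AN/Mk_Lgen/LgenW/Lgen_iter_comm.
Qed.

(** Induction on the nilpotency order of ad t at a: a t^(d+1) = t a t^d - [t,a] t^d, and the
    induction hypothesis for [t,a] extracts a left factor t from the last term. *)
Lemma Mk_exchange k (t a : A) : Mk k a ->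
  exists d a', Mk k a' /\ a * t ^+ d = t * a'.
Proof.
have [d /(_ t a)] := comm_nilpotent; move=> a0 Ma; exists d.
elim: d a Ma a0 => [|d IH] a Ma; first move=> /= ->.
  by exists 0; split; [apply: Mk0 | rewrite mul0r mulr0].
rewrite iterSr => /IH -[|c [Mc tc]]; first exact: Mk_comm.
exists (a * t ^+ d - c); split; first by apply: Mk_sub => //; apply: Mk_mulr.
by rewrite mulrBr -tc exprS /commr; non_commutative_ring.
Qed.

Lemma exchange (t a : A) : exists d a', a * t ^+ d = t * a'.
Proof.
(* With the convention for index 0, M_0 is all of A. *)
have [//|d [a' [_ e]]] := @Mk_exchange 0 t a; last by exists d, a'.
exact: Mk_Lgen.
Qed.

Lemma common_multiple s t : S s -> S t -> exists p q, S (s * p) /\ s * p = t * q.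
Proof.
move=> Ss St; have [d [q e]] := exchange t s.
by exists (t ^+ d), q; split=> //; apply/SM/SX.
Qed.

Lemma j_lcancel s x y : S s -> x * j s = y * j s -> x = y.
Proof. by case/jinv=> u [su _] /(congr1 ( *%R^~ u)); rewrite -!mulrA su !mulr1. Qed.

(** * Right fractions with numerator in M_k *)

Definition fracMk k (x : B) := exists s n, S s /\ Mk k n /\ x * j s = j n.

Lemma fracMk_sub k x y : fracMk k x -> fracMk k y -> fracMk k (x - y).
Proof.
move=> [s [n [Ss [Mn xs]]]] [t [n' [St [Mn' yt]]]].
have [p [q [Sp e]]] := common_multiple Ss St.
exists (s * p), (n * p - n' * q); split=> //; split.
  by apply: Mk_sub; apply: Mk_mulr.
by rewrite mulrBl jB {2}e !jM !mulrA xs yt.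
Qed.

(** With b = a t^-1 and x = n s^-1, the exchange n t^d = t n' turns t^-1 n into n' t^-d, so b x = a
    n' (s t^d)^-1. *)
Lemma fracMk_mull k b x : fracMk k x -> fracMk k (b * x).
Proof.
move=> [s [n [Ss [Mn xs]]]]; have [a [t [St bt]]] := jfrac b.
have [d [n' [Mn' e]]] := Mk_exchange t Mn.
exists (s * t ^+ d), (a * n'); split; first exact/SM/SX.
split; first exact: Mk_mull.
by rewrite jM mulrA -(mulrA b) xs -mulrA -jM e !jM mulrA bt.
Qed.

Lemma fracMk_j k n : Mk k n -> fracMk k (j n).
Proof. by move=> Mn; exists 1, n; rewrite j1 mulr1. Qed.

Lemma iter_commM (T : pzRingType) (s x : T) d :
  iter d (commr s) (x * s) = iter d (commr s) x * s.
Proof. by elim: d => //= d ->; rewrite /commr; non_commutative_ring. Qed.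

Lemma iter_comm_map s a d : iter d (commr (j s)) (j a) = j (iter d (commr s) a).
Proof. by elim: d => //= d ->; rewrite jcomm. Qed.

(* For a suitable common denominator s of its entries x_i, the commutator
   [x_1,[x_2,...]] is the value at m = 0 of [x_1 s^m,[x_2 s^m,...]]. *)
Lemma Lgen_quasipoly k (x : B) : (0 < k)%N -> Lgen k x ->
  exists s0, S s0 /\ forall s, S s -> (exists c, s = s0 * c) ->
    exists F : nat -> B, F 0%N = x /\
      (forall m, exists n, Lgen k n /\ F m.+1 = j n) /\
      exists d, quasipoly (j s) k d F.
Proof.
case: k => // k _; elim: k x => [|k IH] x.
  move=> _; have [a [s0 [Ss0 xs]]] := jfrac x.
  exists s0; split=> // s Ss [c es].
  have xs' : x * j s = j (a * c) by rewrite es !jM mulrA xs.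
  exists (fun m => x * j s ^+ m); split; first exact: mulr1; split.
    by move=> m; exists (a * c * s ^+ m); rewrite exprS mulrA xs' -jX -jM.
  (* Nilpotency of ad s at x is inherited from A: x s comes from A, and right multiplication by s
     commutes with ad s and is injective. *)
  have [d d0] := comm_nilpotent; exists d; apply: quasipoly_monomial.
  by apply: (j_lcancel Ss); rewrite -iter_commM xs' iter_comm_map d0 j0 mul0r.
case=> b [y [Ly ->]]; have [t [St IHy]] := IH y Ly.
have [a [t' [St' bt]]] := jfrac b.
have [p [q [Sp e]]] := common_multiple St St'.
exists (t * p); split=> // s Ss [c es].
(* The induction hypothesis accepts every multiple of t as denominator, so the same s serves both b
   and y. *)
have [|F [F0 [FL QF]]] := IHy s Ss; first by exists (p * c); rewrite mulrA.
have bs : b * j s = j (a * q * c) by rewrite es e !jM !mulrA bt.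
exists (fun m => commr (b * j s ^+ m) (F m)); split.
  by rewrite F0 mulr1.
split.
  move=> m; have [n [Ln ->]] := FL m.
  exists (commr (a * q * c * s ^+ m) n); split; first exact: Lgen_comm.
  by rewrite exprS mulrA bs -jX -jM jcomm.
rewrite -add1n; apply: quasipoly_comm QF.
have [d d0] := comm_nilpotent; exists d; apply: quasipoly_monomial.
by apply: (j_lcancel Ss); rewrite -iter_commM bs iter_comm_map d0 j0 mul0r.
Qed.

Lemma fracMk_Lgen k (x : B) : (0 < k)%N -> Lgen k x -> fracMk k x.
Proof.
move=> k_gt0 /(Lgen_quasipoly k_gt0) [s [Ss /(_ s Ss)]].
case; first by exists 1; rewrite mulr1.
move=> F [<- [FL [d QF]]]; have [u [_ us]] := jinv Ss.
apply: (quasipoly_extrapolate us _ _ QF).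
- exact: fracMk_sub.
- by move=> a y; apply: fracMk_mull.
- by move=> m; have [n [Ln ->]] := FL m; apply/fracMk_j/Mk_Lgen.
Qed.

Lemma Mk_frac k (x : B) : (0 < k)%N -> Mk k x -> fracMk k x.
Proof.
move=> k_gt0; move: x; apply: Mk_ind_left => //.
- by rewrite -j0; apply/fracMk_j/Mk0.
- exact: fracMk_sub.
- by move=> a g Lg; apply/fracMk_mull/fracMk_Lgen.
Qed.

(** Writing j n as a fraction n' s^-1 gives n s t = n' t for some t in S. This controls the kernel
    of N_k(A) -> N_k(B), hence the injectivity of m. *)
Lemma Mk_map_inv k n : (0 < k)%N -> Mk k (j n) -> exists2 s, S s & Mk k (n * s).
Proof.
move=> k_gt0 /(Mk_frac k_gt0) [s [n' [Ss [Mn']]]].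
rewrite -jM => /eqP; rewrite -subr_eq0 -jB => /eqP/jker [t [St /eqP]].
rewrite mulrBl subr_eq0 => /eqP e; exists (s * t); first exact: SM.
by rewrite mulrA e; apply: Mk_mulr.
Qed.

(** * The universal property of N_k(B) over the star localization *)

Section StarLocalization.
Hypothesis Ssat : forall x y, S x -> Mk 2 (x - y) -> S y.
Hypothesis K2 : 2%:R != 0 :> K.
Hypothesis K3 : 3%:R != 0 :> K.
Variables (R : comPzRingType) (phi : A -> R).
Hypothesis philoc : is_star_localization S phi.
Variables (k : nat) (W : zmodType) (f : R -> A -> W).
Hypothesis k_gt0 : (0 < k)%N.
Hypothesis fbal : balanced_map k phi f.

Local Notation h := (halfA A).
Local Notation starA := (starp h).
Local Notation starB := (starp (j h)).
Local Notation thirdA := ((3%:R)^-1 *: 1 : A).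

Let phiM x y : phi (starA x y) = phi x * phi y.
Proof. by case: philoc => _ [_ [+ _]]. Qed.
Let phiinv s : S s -> exists u, phi s * u = 1.
Proof. by case: philoc => _ [_ [_ [+ _]]]; apply. Qed.
Let phi1 : phi 1 = 1. Proof. by case: philoc => _ []. Qed.

Let fDr r n1 n2 : Mk k n1 -> Mk k n2 -> f r (n1 + n2) = f r n1 + f r n2.
Proof. by case: fbal => _ [+ _]; apply. Qed.
Let fW r n : Mk k.+1 n -> f r n = 0.
Proof. by case: fbal => _ [_ [+ _]]; apply. Qed.
Let fphi r c n : Mk k n -> f (r * phi c) n = f r (starA c n).
Proof. by case: fbal => _ [_ [_ +]]; apply. Qed.

Let h2A : h + h = 1 :> A.
Proof. by rewrite /halfA -mulr2n scalerMnl -mulr_natr mulVf // scale1r. Qed.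
Let t3A : thirdA *+ 3 = 1.
Proof. by rewrite scalerMnl -mulr_natr mulVf // scale1r. Qed.
Let h2B : j h + j h = 1. Proof. by rewrite -jD h2A j1. Qed.
Let t3B : j thirdA *+ 3 = 1.
Proof. by rewrite -[RHS]j1 -[in RHS]t3A !mulrS mulr0n !jD j0. Qed.

Let jstar x y : j (starA x y) = starB (j x) (j y).
Proof. by rewrite /starp !(jM, jD). Qed.

Lemma Mk_numerator x : Mk k x -> exists s n,
  S s /\ Mk k n /\ Mk k.+1 (starB (j s) x - j n).
Proof.
move=> Mx; have [s [n [Ss [Mn xs]]]] := Mk_frac k_gt0 Mx.
exists (s * s), (s * n); split; first exact: SM; split; first exact: Mk_mull.
by rewrite !jM -xs mulrA; apply: (starp_sqr_Mk t3B).
Qed.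

(** If n s lies in M_{k+1}, so does s n s, hence s s annihilates n in N_k(A). As [phi (s * s)] is
    invertible, it can be split off r and moved onto n. *)
Lemma balanced_map_ker r n : Mk k n -> Mk k.+1 (j n) -> f r n = 0.
Proof.
move=> Mn /(Mk_map_inv (ltn0Sn k)) [s Ss Mns].
have [u su] := phiinv (SM Ss Ss).
rewrite -[r]mulr1 -su mulrA mulrAC fphi //; apply: fW.
rewrite -[X in Mk _ X](subrK (s * n * s)); apply: Mk_add.
  exact: (starp_sqr_Mk t3A).
by rewrite -mulrA; apply: Mk_mull.
Qed.

Lemma balanced_map_eq r n n' : Mk k n -> Mk k n' -> Mk k.+1 (j n - j n') ->
  f r n = f r n'.
Proof.
move=> Mn Mn' Mnn'; rewrite -[n in LHS](subrK n') fDr //; last exact: Mk_sub.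
by rewrite balanced_map_ker ?add0r ?jB //; apply: Mk_sub.
Qed.

(* w = g(x) for the factorization g of f through m: if s * x = j n in
   N_k(A[S^{-1}]) then x = m (1/s (x) n). *)
Definition factor_graph (x : B) (w : W) := exists s n r,
  S s /\ Mk k n /\ Mk k.+1 (starB (j s) x - j n) /\ phi s * r = 1 /\ w = f r n.

Lemma factor_graph_total x : Mk k x -> exists w, factor_graph x w.
Proof.
move=> /Mk_numerator [s [n [Ss [Mn sx]]]]; have [r sr] := phiinv Ss.
by exists (f r n), s, n, r.
Qed.

(** Over the common coefficient r r' the two values have numerators t star n and s star n'. Both
    represent the product of s, t and x in N_k(B), since the star actions of s and t commute
    there. *)
Lemma factor_graph_fun x w w' : Mk k x -> factor_graph x w -> factor_graph x w' ->
  w = w'.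
Proof.
move=> Mx [s [n [r [Ss [Mn [sx [sr ->]]]]]]] [t [n' [r' [St [Mn' [tx [tr ->]]]]]]].
have er : r = r * r' * phi t by rewrite -mulrA [r' * _]mulrC tr mulr1.
have er' : r' = r * r' * phi s by rewrite mulrAC [r * _]mulrC sr mul1r.
rewrite {1}er {2}er' !fphi //; apply: balanced_map_eq; try exact: Mk_starp.
have -> : j (starA t n) - j (starA s n') = starB (j s) (starB (j t) x - j n')
  - starB (j t) (starB (j s) x - j n)
  + (starB (j t) (starB (j s) x) - starB (j s) (starB (j t) x)).
  by rewrite !starpBr !jstar; non_commutative_ring.
apply: Mk_add; last exact: (starpCA_Mk t3B).
by apply: Mk_sub; apply: Mk_starp.
Qed.

Lemma factor_graphD x y w w' : Mk k x -> Mk k y ->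
  factor_graph x w -> factor_graph y w' -> factor_graph (x + y) (w + w').
Proof.
move=> Mx My [s [n [r [Ss [Mn [sx [sr ->]]]]]]] [t [n' [r' [St [Mn' [ty [tr ->]]]]]]].
(* The denominator is a star product because [phi] is multiplicative for that product. It lies in S
   since it differs from t s by half of [t,s], an element of M_2. *)
exists (starA t s), (starA t n + starA s n'), (r * r').
split.
  apply: Ssat (SM St Ss) _.
  have -> : t * s - starA t s = h * commr t s.
    by rewrite -{1}(mul_half_add h2A (t * s)) /starp /commr; non_commutative_ring.
  exact/Mk_mull/Mk_Lgen/(Lgen_comm (k := 1)).
split; first by apply: Mk_add; apply: Mk_starp.
split.
  have -> : starB (j (starA t s)) (x + y) - j (starA t n + starA s n')
    = (starB (j (starA t s)) x - starB (j t) (j n))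
      + (starB (j (starA s t)) y - starB (j s) (j n')).
    by rewrite [starA s t]starpC starpDr jD !jstar opprD addrACA.
  have Mstep a b z m : Mk k z -> Mk k.+1 (starB (j b) z - j m) ->
      Mk k.+1 (starB (j (starA a b)) z - starB (j a) (j m)).
    move=> Mz bz; rewrite jstar -(subrKA (starB (j a) (starB (j b) z))) addrC.
    apply: Mk_add; first by rewrite -starpBr; apply: Mk_starp.
    by rewrite -opprB; apply/Mk_opp/(starpA_Mk t3B).
  by apply: Mk_add; apply: Mstep.
split; first by rewrite phiM [phi t * _]mulrC mulrACA sr tr mulr1.
rewrite fDr; [|exact: Mk_starp..].
rewrite -!fphi //; congr (f _ _ + f _ _).
  by rewrite -mulrA [r' * _]mulrC tr mulr1.
by rewrite mulrAC [r * _]mulrC sr mul1r.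
Qed.

Lemma factor_graph_ker x : Mk k.+1 x -> factor_graph x 0.
Proof.
move=> Mx; exists 1, 0, 1; split=> //; split; first exact: Mk0.
split; first by rewrite j1 j0 subr0 starp1.
by rewrite phi1 mulr1 fW //; apply: Mk0.
Qed.

Lemma factor_graph_m r a s u n : S s -> r * phi s = phi a -> j s * u = 1 ->
  Mk k n -> factor_graph (starB (starB (j a) u) (j n)) (f r n).
Proof.
move=> Ss ra su Mn; have [v [sv vs]] := jinv Ss.
(* The right inverse u of the unit [j s] is two-sided. *)
have us : u * j s = 1 by rewrite -[in LHS](mul1r u) -vs -(mulrA v) su mulr1.
have [r' sr'] := phiinv Ss.
exists s, (starA a n), r'; split=> //; split; first exact: Mk_starp.
split; first by rewrite jstar; apply: (starp_inv_Mk t3B) => //; apply: Mk_map.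
by split=> //; rewrite -fphi // -ra mulrCA [r' * _]mulrC sr' mulr1.
Qed.

Lemma factorization_exists : exists g : B -> W, factors_through_m k S phi j f g.
Proof.
(* Choice from the graph, with default 0 where it is empty. Only values on M_k(B) matter, and there
   the graph is total and single-valued. *)
pose g x := xget 0 [set w | factor_graph x w].
have gP x : Mk k x -> factor_graph x (g x).
  by move=> /factor_graph_total [w xw]; apply: (xgetPex 0); exists w.
have gE x w : Mk k x -> factor_graph x w -> g x = w.
  by move=> Mx; apply: factor_graph_fun => //; apply: gP.
exists g; split=> [x y Mx My|].
  by apply: gE; [exact: Mk_add | apply: factor_graphD => //; exact: gP].
split=> [x Mx|r a s u n Ss ra su Mn].
  by apply: gE; [exact: MkW | exact: factor_graph_ker].
apply: gE; last exact: (factor_graph_m Ss ra su Mn).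
by apply/Mk_starp/Mk_map.
Qed.

(** Star multiplication by u = s^-1 recovers x from s star x, so x agrees modulo M_{k+1} with u star
    n, the image under m of 1/s tensor n. There g is prescribed by f. *)
Lemma factorization_value g x s n r : factors_through_m k S phi j f g ->
  Mk k x -> S s -> Mk k n -> Mk k.+1 (starB (j s) x - j n) -> phi s * r = 1 ->
  g x = f r n.
Proof.
move=> [gD [g0 gm]] Mx Ss Mn sx sr; have [u [su us]] := jinv Ss.
rewrite -(gm r 1 s u n) ?phi1 // 1?mulrC //.
rewrite j1 starp1 //; set y := starB u (j n).
have Mjn := Mk_map Mn.
have Mxy : Mk k.+1 (x - y).
  have us1 : starB u (j s) = 1 by rewrite /starp su us mul_half_add.
  have -> : x - y = starB u (starB (j s) x - j n)
    - (starB u (starB (j s) x) - starB (starB u (j s)) x).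
    by rewrite us1 starp1 // starpBr opprB [RHS]addrC subrKA.
  by apply: Mk_sub; [apply: Mk_starp | apply: (starpA_Mk t3B)].
rewrite -{1}(subrK y x) gD; [|exact: MkW|exact: Mk_starp].
by rewrite (g0 _ Mxy) add0r.
Qed.

Lemma factorization_unique g1 g2 :
  factors_through_m k S phi j f g1 -> factors_through_m k S phi j f g2 ->
  forall x, Mk k x -> g1 x = g2 x.
Proof.
move=> f1 f2 x Mx; have [s [n [Ss [Mn sx]]]] := Mk_numerator Mx.
have [r sr] := phiinv Ss.
rewrite (factorization_value f1 Mx Ss Mn sx sr).
by rewrite (factorization_value f2 Mx Ss Mn sx sr).
Qed.

End StarLocalization.
End OreLocalization.

Theorem theorem3p1 (RR : realType) (A : algType RR[i]) (S : A -> Prop) :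
  fin_gen_alg A ->
  (exists N : nat, forall x : A, Mk N x -> x = 0) ->
  preimage_of_mult_nzd S ->
  forall k : nat, (1 <= k)%N ->
  forall (R : comPzRingType) (phi : A -> R), is_star_localization S phi ->
  forall (B : pzRingType) (j : A -> B), is_ore_localization S j ->
  m_is_iso k S phi j.
Proof.
move=> _ A_nil [Ssat [S1 [SM _]]] k k_gt0 R phi philoc B j jloc W f fbal.
(* Characteristic zero: n = 1 and n = 2 give the invertibility of 2 and 3. *)
have nz n : n.+1%:R != 0 :> RR[i] by rewrite Num.Theory.pnatr_eq0.
split; first exact: (factorization_exists S1 SM A_nil jloc Ssat (nz 1%N) (nz 2%N)
  philoc k_gt0 fbal).
move=> g1 g2; exact: (factorization_unique S1 SM A_nil jloc (nz 1%N) (nz 2%N)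
  philoc k_gt0 (f := f)).
Qed.
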